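(* For all $s > 0$, $$\theta_4''(s)\theta_4(s) - \theta_4'(s)^2 < -\frac{\theta_4'(s)\theta_4(s)}{s} < 0.$$
   Context: For $s>0$, $\theta_4(s) = \sum_{k\in\mathbb{Z}} (-1)^k e^{-\pi k^2 s}$. *)

(* Defs.v *)
From Stdlib Require Import Reals ZArith ClassicalEpsilon.
Open Scope R_scope.

Definition theta4_partial (s : R) (N : nat) : R :=
  sum_f_R0 (fun i : nat =>
    let k : Z := (Z.of_nat i - Z.of_nat N)%Z in
    powerRZ (-1) k * exp (- PI * (IZR k) ^ 2 * s)) (2 * N).

(* theta_4(s) = sum_{k in Z} (-1)^k e^{-pi k^2 s}  (absolutely convergent for s>0,
   so the limit of symmetric partial sums is the sum over Z). *)
Definition theta4 (s : R) : R :=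
  epsilon (inhabits 0) (fun l => Un_cv (theta4_partial s) l).

(* Main.v *)
(** With [q = exp (-PI s)], Gauss' product
    [theta4 s = prod_(j >= 1) (1 - q^j) / (1 + q^j)] follows from a finite
    identity of Shanks type, in which the partial theta sum differs from the
    partial product by [O(q^n)].  In the variable [t = ln s] each factor is
    [tanh (j PI e^t / 2)], whose logarithm has derivative [x / sinh x > 0] at
    [x = j PI e^t]; as [x / sinh x] is decreasing, every [ln] of a factor is
    increasing and strictly concave in [t].  The claim says exactly that
    [ln (theta4 (e^t))] has positive first and negative second derivative.
    Monotonicity and midpoint concavity survive the pointwise limit, the first
    factor is split off to keep strictness, and the derivatives themselves come
    from the power series of [theta4] in [q]. *)

Require Import Defs.
From Stdlib Require Import Reals ZArith Lra Lia ClassicalEpsilon.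
From Coquelicot Require Import Coquelicot.
Open Scope R_scope.

Fixpoint theta_sum (q : R) (n : nat) : R :=
  match n with
  | O => 1
  | S m => theta_sum q m + 2 * (-1) ^ S m * q ^ (S m * S m)
  end.

Fixpoint gauss_prod (q : R) (n : nat) : R :=
  match n with
  | O => 1
  | S m => gauss_prod q m * ((1 - q ^ S m) / (1 + q ^ S m))
  end.

Definition shanks_term (q : R) (n i : nat) : R :=
  (-1) ^ i * (2 / (1 + q ^ i)) * (gauss_prod q n / gauss_prod q i)
  * q ^ (i * S n).

Lemma pow_S_lt_1 (q : R) (n : nat) : 0 < q < 1 -> 0 < q ^ S n < 1.
Proof.
  intros Hq; split; [apply pow_lt; lra|].
  apply pow_lt_1_compat; [lra|lia].
Qed.

Lemma pow_le_1 (q : R) (n : nat) : 0 < q < 1 -> 0 < q ^ n <= 1.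
Proof.
  intros Hq; destruct n as [|n]; [simpl; lra|].
  pose proof (pow_S_lt_1 q n Hq); lra.
Qed.

Lemma gauss_prod_pos (q : R) (n : nat) : 0 < q < 1 -> 0 < gauss_prod q n.
Proof.
  intros Hq; induction n as [|n IH]; cbn [gauss_prod]; [lra|].
  pose proof (pow_S_lt_1 q n Hq).
  apply Rmult_lt_0_compat; [exact IH|apply Rdiv_lt_0_compat; lra].
Qed.

Lemma gauss_prod_decr (q : R) (n i : nat) :
  0 < q < 1 -> (i <= n)%nat -> gauss_prod q n <= gauss_prod q i.
Proof.
  intros Hq Hi; induction Hi as [|n Hi IH]; [lra|]; cbn [gauss_prod].
  pose proof (pow_S_lt_1 q n Hq); pose proof (gauss_prod_pos q n Hq).
  assert (H1 : (1 - q ^ S n) / (1 + q ^ S n) <= 1)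
    by (apply Rle_div_l; lra).
  nra.
Qed.

(* The increments in [n] telescope: with [U i = q^(i(n+1)) / P_(i-1)] they are
   [-2 P_n / (1 + q^(n+1)) * (-1)^i * (U i + U (i+1))]. *)
Lemma shanks_increment_sum (q : R) (n m : nat) :
  0 < q < 1 ->
  sum_f_R0 (fun i => shanks_term q (S n) i - shanks_term q n i) m =
  - (2 / (1 + q ^ S n)) * gauss_prod q n * (-1) ^ m
  * (q ^ (S m * S n) / gauss_prod q m).
Proof.
  intros Hq; pose proof (pow_S_lt_1 q n Hq) as Hn.
  induction m as [|m IH].
  - unfold shanks_term; cbn [sum_f_R0 gauss_prod].
    replace (1 * S n)%nat with (S n) by lia.
    rewrite !Nat.mul_0_l, !pow_O.
    set (y := q ^ S n) in *; field; lra.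
  - rewrite tech5, IH; unfold shanks_term; cbn [gauss_prod].
    pose proof (pow_S_lt_1 q m Hq) as Hm.
    pose proof (gauss_prod_pos q n Hq); pose proof (gauss_prod_pos q m Hq).
    replace (S m * S (S n))%nat with (S m * S n + S m)%nat by lia.
    replace (S (S m) * S n)%nat with (S m * S n + S n)%nat by lia.
    rewrite !pow_add, <- (tech_pow_Rmult (-1) m).
    set (y := q ^ S n) in *; set (x := q ^ S m) in *.
    set (z := q ^ (S m * S n)); set (e := (-1) ^ m).
    field; repeat split; lra.
Qed.

Lemma shanks_identity (q : R) (n : nat) :
  0 < q < 1 -> sum_f_R0 (shanks_term q n) n = theta_sum q n.
Proof.
  intros Hq; induction n as [|n IH].
  - unfold shanks_term; simpl; field.
  - cbn [theta_sum]; rewrite <- IH, tech5.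
    pose proof (shanks_increment_sum q n n Hq) as H.
    rewrite minus_sum in H.
    pose proof (pow_S_lt_1 q n Hq) as Hn.
    pose proof (gauss_prod_pos q n Hq) as Hg.
    pose proof (gauss_prod_pos q (S n) Hq) as Hg'.
    assert (E : shanks_term q (S n) (S n)
                = (-1) ^ S n * (2 / (1 + q ^ S n)) * q ^ S n * q ^ (S n * S n)).
    { unfold shanks_term.
      replace (S n * S (S n))%nat with (S n * S n + S n)%nat by lia.
      rewrite pow_add; field; split; lra. }
    rewrite E.
    replace (sum_f_R0 (shanks_term q (S n)) n) with
      (sum_f_R0 (shanks_term q n) n
       + - (2 / (1 + q ^ S n)) * gauss_prod q n * (-1) ^ n
         * (q ^ (S n * S n) / gauss_prod q n)) by lra.
    rewrite <- (tech_pow_Rmult (-1) n).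
    set (y := q ^ S n) in *; set (z := q ^ (S n * S n)).
    field; split; lra.
Qed.

Lemma shanks_term_0 (q : R) (n : nat) : shanks_term q n 0 = gauss_prod q n.
Proof. unfold shanks_term; simpl; field. Qed.

Lemma shanks_term_bound (q : R) (n i : nat) :
  0 < q < 1 -> (S i <= n)%nat ->
  Rabs (shanks_term q n (S i)) <= q ^ i * (2 * q ^ n).
Proof.
  intros Hq Hi; unfold shanks_term.
  rewrite !Rabs_mult, pow_1_abs, Rmult_1_l.
  pose proof (pow_S_lt_1 q i Hq).
  pose proof (gauss_prod_pos q n Hq); pose proof (gauss_prod_pos q (S i) Hq).
  pose proof (gauss_prod_decr q n (S i) Hq Hi).
  replace (S i * S n)%nat with (n + i + (i * n + 1))%nat by lia.
  rewrite (pow_add q (n + i)), (pow_add q n i).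
  pose proof (pow_le_1 q (i * n + 1) Hq); pose proof (pow_le_1 q n Hq).
  pose proof (pow_le_1 q i Hq).
  assert (0 < 2 / (1 + q ^ S i) <= 2).
  { split; [apply Rdiv_lt_0_compat; lra|apply Rle_div_l; lra]. }
  assert (0 < gauss_prod q n / gauss_prod q (S i) <= 1).
  { split; [apply Rdiv_lt_0_compat; lra|apply Rle_div_l; lra]. }
  assert (0 < q ^ n * q ^ i) by (apply Rmult_lt_0_compat; lra).
  set (u := 2 / (1 + q ^ S i)) in *.
  set (v := gauss_prod q n / gauss_prod q (S i)) in *.
  replace (q ^ i * (2 * q ^ n)) with (2 * (q ^ n * q ^ i)) by ring.
  set (d := q ^ n * q ^ i) in *.
  set (w := q ^ (i * n + 1)) in *.
  assert (0 < u * v <= 2) by nra.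
  assert (0 < d * w <= d) by nra.
  rewrite (Rabs_pos_eq u), (Rabs_pos_eq v), (Rabs_pos_eq (d * w)) by lra.
  nra.
Qed.

Lemma theta_sum_gauss_prod (q : R) (n : nat) :
  0 < q < 1 -> Rabs (theta_sum q n - gauss_prod q n) <= 2 / (1 - q) * q ^ n.
Proof.
  intros Hq.
  pose proof (pow_le_1 q n Hq) as Hn.
  assert (Hc : 0 < 2 / (1 - q)) by (apply Rdiv_lt_0_compat; lra).
  destruct n as [|n]; [simpl; rewrite Rminus_diag, Rabs_R0; nra|].
  rewrite <- shanks_identity, decomp_sum, shanks_term_0 by (assumption || lia).
  rewrite Rplus_minus_l; cbn [pred].
  eapply Rle_trans; [apply Rsum_abs|].
  eapply Rle_trans.
  { apply sum_Rle; intros i Hi; apply shanks_term_bound; [exact Hq|lia]. }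
  rewrite <- scal_sum, tech3 by lra.
  pose proof (pow_le_1 q (S n) Hq).
  unfold Rdiv; rewrite (Rmult_comm _ (/ (1 - q))), <- !Rmult_assoc.
  assert (0 < / (1 - q)) by (apply Rinv_0_lt_compat; lra).
  nra.
Qed.

(* From [(1 + x)/(1 - x) <= exp (2x/(1 - x))]. *)
Lemma gauss_prod_lower (q : R) (n : nat) :
  0 < q < 1 -> exp (- (2 / (1 - q) ^ 2)) <= gauss_prod q n.
Proof.
  intros Hq.
  assert (Hc : 0 < 2 / (1 - q)) by (apply Rdiv_lt_0_compat; lra).
  assert (H : exp (- (2 / (1 - q)) * ((1 - q ^ S n) / (1 - q) - 1))
              <= gauss_prod q n).
  { induction n as [|n IH].
    - replace (- (2 / (1 - q)) * ((1 - q ^ 1) / (1 - q) - 1)) with 0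
        by (field; lra).
      rewrite exp_0; simpl; lra.
    - cbn [gauss_prod].
      pose proof (pow_S_lt_1 q n Hq) as Hn.
      rewrite <- (tech_pow_Rmult q (S n)).
      assert (Hnq : q ^ S n <= q)
        by (rewrite <- tech_pow_Rmult; pose proof (pow_le_1 q n Hq); nra).
      set (x := q ^ S n) in *.
      replace (- (2 / (1 - q)) * ((1 - q * x) / (1 - q) - 1)) with
        (- (2 / (1 - q)) * ((1 - x) / (1 - q) - 1) + - (2 / (1 - q) * x))
        by (field; lra).
      rewrite exp_plus.
      apply Rmult_le_compat; try (left; apply exp_pos); [exact IH|].
      rewrite exp_Ropp.
      replace ((1 - x) / (1 + x)) with (/ (1 + 2 * x / (1 - x)))
        by (field; lra).
      assert (0 < 2 * x / (1 - x)) by (apply Rdiv_lt_0_compat; lra).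
      apply Rinv_le_contravar; [lra|].
      assert (2 * x / (1 - x) <= 2 / (1 - q) * x).
      { unfold Rdiv.
        assert (/ (1 - x) <= / (1 - q)) by (apply Rinv_le_contravar; lra).
        nra. }
      pose proof (exp_ineq1_le (2 / (1 - q) * x)); lra. }
  eapply Rle_trans; [|exact H].
  assert (Hle : (1 - q ^ S n) / (1 - q) - 1 <= 1 / (1 - q)).
  { pose proof (pow_S_lt_1 q n Hq).
    apply Rle_trans with ((1 - q ^ S n) / (1 - q)); [lra|].
    unfold Rdiv; apply Rmult_le_compat_r;
      [left; apply Rinv_0_lt_compat|]; lra. }
  replace (2 / (1 - q) ^ 2) with (2 / (1 - q) * (1 / (1 - q))) by (field; lra).
  assert (Hexp : forall u v, u <= v -> exp u <= exp v).
  { intros u v [Huv|<-]; [left; now apply exp_increasing|lra]. }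
  apply Hexp; nra.
Qed.

Definition theta_coef (n : nat) : R :=
  if Nat.eqb n 0 then 1
  else if Nat.eqb (Nat.sqrt n * Nat.sqrt n) n then 2 * (-1) ^ Nat.sqrt n else 0.

Lemma theta_coef_bound (n : nat) : Rabs (theta_coef n) <= 2.
Proof.
  unfold theta_coef.
  destruct (Nat.eqb n 0); [rewrite Rabs_R1; lra|].
  destruct (Nat.eqb _ n); [|rewrite Rabs_R0; lra].
  rewrite Rabs_mult, pow_1_abs, Rabs_pos_eq; lra.
Qed.

Lemma theta_coef_partial_sum (q : R) (N : nat) :
  sum_f_R0 (fun n => theta_coef n * q ^ n) (N * N) = theta_sum q N.
Proof.
  induction N as [|N IH]; [cbn; lra|].
  assert (Hgap : forall m, (m <= 2 * N)%nat ->
    sum_f_R0 (fun n => theta_coef n * q ^ n) (N * N + m) = theta_sum q N).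
  { induction m as [|m IHm]; intros Hm; [rewrite Nat.add_0_r; exact IH|].
    rewrite Nat.add_succ_r, tech5, IHm by lia.
    unfold theta_coef; cbn [Nat.eqb].
    rewrite (Nat.sqrt_unique (S (N * N + m)) N) by lia.
    destruct (Nat.eqb_spec (N * N) (S (N * N + m))); [lia|lra]. }
  replace (S N * S N)%nat with (S (N * N + 2 * N)) at 1 by lia.
  rewrite tech5, Hgap by lia.
  replace (S (N * N + 2 * N)) with (S N * S N)%nat by lia.
  cbn [theta_sum]; unfold theta_coef.
  rewrite (Nat.sqrt_unique (S N * S N) (S N)), Nat.eqb_refl by lia.
  reflexivity.
Qed.

Lemma theta_coef_radius (q : R) :
  0 < q < 1 -> Rbar_lt (Rabs q) (CV_radius theta_coef).
Proof.
  intros Hq; rewrite Rabs_pos_eq by lra.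
  apply Rbar_lt_le_trans with 1; [simpl; lra|].
  apply (CV_radius_bounded theta_coef); exists 2; intros n.
  rewrite pow1, Rmult_1_r; apply theta_coef_bound.
Qed.

Lemma theta_sum_cvg (q : R) :
  0 < q < 1 -> is_lim_seq (theta_sum q) (PSeries theta_coef q).
Proof.
  intros Hq.
  pose proof (PSeries_correct _ _
                (CV_radius_inside _ _ (theta_coef_radius q Hq))) as H.
  apply is_pseries_R in H.
  assert (Hs : is_lim_seq (sum_n (fun n => theta_coef n * q ^ n))
                 (PSeries theta_coef q)) by exact H.
  apply is_lim_seq_ext with
    (fun N => sum_n (fun n => theta_coef n * q ^ n) (N * N)%nat).
  { intros N; rewrite sum_n_Reals; apply theta_coef_partial_sum. }
  apply (is_lim_seq_subseq _ _ (fun N => (N * N)%nat)); [|exact Hs].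
  apply eventually_subseq; intros N; nia.
Qed.

Lemma gauss_prod_cvg (q : R) :
  0 < q < 1 -> is_lim_seq (gauss_prod q) (PSeries theta_coef q).
Proof.
  intros Hq.
  apply is_lim_seq_ext with
    (fun n => theta_sum q n - (theta_sum q n - gauss_prod q n)).
  { intros n; ring. }
  replace (Finite (PSeries theta_coef q))
    with (Finite (PSeries theta_coef q - 0)) by (f_equal; ring).
  apply is_lim_seq_minus'; [now apply theta_sum_cvg|].
  apply is_lim_seq_abs_0.
  apply is_lim_seq_le_le with (fun _ => 0) (fun n => 2 / (1 - q) * q ^ n).
  - intros n; split; [apply Rabs_pos|now apply theta_sum_gauss_prod].
  - apply is_lim_seq_const.
  - replace (Finite 0) with (Rbar_mult (2 / (1 - q)) 0)
      by (simpl; f_equal; ring).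
    apply is_lim_seq_scal_l, is_lim_seq_geom; rewrite Rabs_pos_eq; lra.
Qed.

Lemma theta_series_pos (q : R) : 0 < q < 1 -> 0 < PSeries theta_coef q.
Proof.
  intros Hq.
  apply Rlt_le_trans with (exp (- (2 / (1 - q) ^ 2))); [apply exp_pos|].
  exact (is_lim_seq_le _ _ _ _ (fun n => gauss_prod_lower q n Hq)
           (is_lim_seq_const _) (gauss_prod_cvg q Hq)).
Qed.

Definition nome (s : R) : R := exp (- PI * s).

Lemma nome_bounds (s : R) : 0 < s -> 0 < nome s < 1.
Proof.
  intros Hs; split; [apply exp_pos|].
  rewrite <- exp_0; apply exp_increasing; pose proof PI_RGT_0; nra.
Qed.

Lemma exp_INR_mult (x : R) (n : nat) : exp (INR n * x) = exp x ^ n.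
Proof.
  induction n as [|n IH]; [simpl; rewrite Rmult_0_l; apply exp_0|].
  rewrite S_INR, Rmult_plus_distr_r, Rmult_1_l, exp_plus, IH; simpl; ring.
Qed.

Lemma theta4_partial_theta_sum (s : R) (N : nat) :
  theta4_partial s N = theta_sum (nome s) N.
Proof.
  assert (Hpow : forall n, exp (- PI * INR n ^ 2 * s) = nome s ^ (n * n)).
  { intros n; unfold nome; rewrite <- exp_INR_mult, mult_INR; f_equal; ring. }
  induction N as [|N IH].
  - unfold theta4_partial; simpl.
    rewrite Rmult_0_l, Rmult_0_r, Rmult_0_l, exp_0; ring.
  - cbn [theta_sum]; rewrite <- IH; unfold theta4_partial.
    replace (2 * S N)%nat with (S (S (2 * N))) by lia.
    rewrite tech5, decomp_sum by lia; cbn [pred].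
    replace (Z.of_nat 0 - Z.of_nat (S N))%Z with (- Z.of_nat (S N))%Z by lia.
    replace (Z.of_nat (S (S (2 * N))) - Z.of_nat (S N))%Z
      with (Z.of_nat (S N)) by lia.
    rewrite opp_IZR, <- !INR_IZR_INZ, powerRZ_neg', <- pow_powerRZ.
    replace ((- INR (S N)) ^ 2) with (INR (S N) ^ 2) by ring.
    rewrite Hpow.
    rewrite (sum_eq
      (fun i => powerRZ (-1) (Z.of_nat (S i) - Z.of_nat (S N)) *
                exp (- PI * IZR (Z.of_nat (S i) - Z.of_nat (S N)) ^ 2 * s))
      (fun i => powerRZ (-1) (Z.of_nat i - Z.of_nat N) *
                exp (- PI * IZR (Z.of_nat i - Z.of_nat N) ^ 2 * s))).
    2:{ intros i _.
        replace (Z.of_nat (S i) - Z.of_nat (S N))%Z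
          with (Z.of_nat i - Z.of_nat N)%Z by lia; reflexivity. }
    assert (Hinv : / (-1) ^ S N = (-1) ^ S N).
    { rewrite <- pow_inv; f_equal; field. }
    rewrite Hinv; ring.
Qed.

Lemma theta4_series (s : R) : 0 < s -> theta4 s = PSeries theta_coef (nome s).
Proof.
  intros Hs.
  assert (H : Un_cv (theta4_partial s) (PSeries theta_coef (nome s))).
  { apply is_lim_seq_Reals.
    apply is_lim_seq_ext with (theta_sum (nome s)).
    - intros N; symmetry; apply theta4_partial_theta_sum.
    - now apply theta_sum_cvg, nome_bounds. }
  eapply UL_sequence; [|exact H].
  unfold theta4; apply epsilon_spec; eexists; exact H.
Qed.

Definition theta4_d1 (s : R) : R :=
  - PI * nome s * PSeries (PS_derive theta_coef) (nome s).

Definition theta4_d2 (s : R) : R :=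
  PI ^ 2 * nome s * PSeries (PS_derive theta_coef) (nome s)
  + PI ^ 2 * nome s ^ 2 * PSeries (PS_derive (PS_derive theta_coef)) (nome s).

Lemma is_derive_nome (s : R) : is_derive nome s (- PI * nome s).
Proof. unfold nome; auto_derive; [exact I|ring]. Qed.

Lemma is_derive_PSeries_nome (a : nat -> R) (s : R) :
  Rbar_lt (Rabs (nome s)) (CV_radius a) ->
  is_derive (fun u => PSeries a (nome u)) s
    (- PI * nome s * PSeries (PS_derive a) (nome s)).
Proof.
  intros Ha.
  exact (is_derive_comp (PSeries a) nome s _ _
           (is_derive_PSeries a _ Ha) (is_derive_nome s)).
Qed.

Lemma theta4_derive (s : R) : 0 < s -> is_derive theta4 s (theta4_d1 s).
Proof.
  intros Hs.
  apply is_derive_ext_loc with (fun u => PSeries theta_coef (nome u)).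
  { exists (mkposreal s Hs); intros u Hu; symmetry; apply theta4_series.
    apply Rabs_lt_between in Hu; simpl in Hu.
    unfold minus, plus, opp in Hu; simpl in Hu; lra. }
  apply is_derive_PSeries_nome, theta_coef_radius, nome_bounds, Hs.
Qed.

Lemma theta4_derive2 (s : R) : 0 < s -> is_derive theta4_d1 s (theta4_d2 s).
Proof.
  intros Hs; unfold theta4_d1, theta4_d2.
  assert (H : is_derive (fun u => PSeries (PS_derive theta_coef) (nome u)) s
            (- PI * nome s * PSeries (PS_derive (PS_derive theta_coef)) (nome s))).
  { apply is_derive_PSeries_nome; rewrite CV_radius_derive.
    apply theta_coef_radius, nome_bounds, Hs. }
  pose proof (is_derive_scal nome s (- PI) _ (is_derive_nome s)) as Hn.
  pose proof (is_derive_mult (fun u => - PI * nome u) _ s _ _ Hn H Rmult_comm)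
    as Hm.
  eapply eq_ind; [exact Hm|].
  unfold plus, mult; simpl; ring.
Qed.

Lemma sinh_pos (x : R) : 0 < x -> 0 < sinh x.
Proof.
  intros Hx; unfold sinh.
  pose proof (exp_increasing (- x) x ltac:(lra)); lra.
Qed.

Lemma sinh_lt_mul_cosh (x : R) : 0 < x -> sinh x < x * cosh x.
Proof.
  intros Hx.
  destruct (MVT_cor2 sinh cosh 0 x Hx
              (fun c _ => derivable_pt_lim_sinh c)) as (c & Hc & Hc0).
  destruct (MVT_cor2 cosh sinh c x (proj2 Hc0)
              (fun d _ => derivable_pt_lim_cosh d)) as (d & Hd & Hd0).
  pose proof (sinh_pos d ltac:(lra)).
  assert (cosh c < cosh x) by nra.
  replace (sinh x) with (x * cosh c) by (rewrite sinh_0 in Hc; lra).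
  apply Rmult_lt_compat_l; assumption.
Qed.

Definition log_tanh_exp (a t : R) : R :=
  ln ((1 - exp (- (a * exp t))) / (1 + exp (- (a * exp t)))).

Definition log_tanh_exp_d1 (a t : R) : R := a * exp t / sinh (a * exp t).

Definition log_tanh_exp_d2 (a t : R) : R :=
  a * exp t * (sinh (a * exp t) - a * exp t * cosh (a * exp t))
  / sinh (a * exp t) ^ 2.

Lemma log_tanh_exp_derive (a t : R) :
  0 < a -> derivable_pt_lim (log_tanh_exp a) t (log_tanh_exp_d1 a t).
Proof.
  intros Ha; apply is_derive_Reals.
  unfold log_tanh_exp, log_tanh_exp_d1, sinh.
  pose proof (exp_pos t).
  assert (Hx : 0 < a * exp t) by nra.
  assert (He : 0 < exp (- (a * exp t)) < 1).
  { split; [apply exp_pos|]; rewrite <- exp_0; apply exp_increasing; lra. }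
  auto_derive.
  - repeat split; try lra; apply Rdiv_lt_0_compat; lra.
  - replace (exp (a * exp t)) with (/ exp (- (a * exp t)))
      by (rewrite <- exp_Ropp, Ropp_involutive; reflexivity).
    set (y := exp (- (a * exp t))) in *.
    field; repeat split; try lra; nra.
Qed.

Lemma log_tanh_exp_derive2 (a t : R) :
  0 < a -> derivable_pt_lim (log_tanh_exp_d1 a) t (log_tanh_exp_d2 a t).
Proof.
  intros Ha; apply is_derive_Reals.
  pose proof (exp_pos t).
  assert (Hx : 0 < a * exp t) by nra.
  pose proof (sinh_pos _ Hx) as Hs.
  unfold log_tanh_exp_d1, log_tanh_exp_d2, cosh; unfold sinh in *.
  auto_derive.
  - lra.
  - field; lra.
Qed.

Lemma log_tanh_exp_d1_pos (a t : R) : 0 < a -> 0 < log_tanh_exp_d1 a t.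
Proof.
  intros Ha; pose proof (exp_pos t).
  apply Rdiv_lt_0_compat; [nra|apply sinh_pos; nra].
Qed.

Lemma log_tanh_exp_d2_neg (a t : R) : 0 < a -> log_tanh_exp_d2 a t < 0.
Proof.
  intros Ha; pose proof (exp_pos t).
  assert (Hx : 0 < a * exp t) by nra.
  pose proof (sinh_lt_mul_cosh _ Hx); pose proof (sinh_pos _ Hx).
  unfold log_tanh_exp_d2.
  apply Rdiv_neg_pos; [nra|apply pow_lt; lra].
Qed.

Lemma log_tanh_exp_incr (a t e : R) :
  0 < a -> 0 < e -> log_tanh_exp a t <= log_tanh_exp a (t + e).
Proof.
  intros Ha He.
  destruct (MVT_cor2 _ _ t (t + e) ltac:(lra)
              (fun c _ => log_tanh_exp_derive a c Ha)) as (c & Hc & _).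
  pose proof (log_tanh_exp_d1_pos a c Ha); nra.
Qed.

Lemma log_tanh_exp_midpoint (a t e : R) :
  0 < a -> 0 < e ->
  log_tanh_exp a (t + e) + log_tanh_exp a (t - e) <= 2 * log_tanh_exp a t.
Proof.
  intros Ha He.
  destruct (MVT_cor2 _ _ t (t + e) ltac:(lra)
              (fun c _ => log_tanh_exp_derive a c Ha)) as (c & Hc & Hct).
  destruct (MVT_cor2 _ _ (t - e) t ltac:(lra)
              (fun c _ => log_tanh_exp_derive a c Ha)) as (d & Hd & Hdt).
  destruct (MVT_cor2 _ _ d c ltac:(lra)
              (fun c _ => log_tanh_exp_derive2 a c Ha)) as (b & Hb & _).
  pose proof (log_tanh_exp_d2_neg a b Ha).
  assert (log_tanh_exp_d1 a c < log_tanh_exp_d1 a d) by nra.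
  nra.
Qed.

Lemma derivative_nonneg_of_le_right (f : R -> R) (t l : R) :
  derivable_pt_lim f t l -> (forall e, 0 < e -> f t <= f (t + e)) -> 0 <= l.
Proof.
  intros Hf Hle; destruct (Rle_or_lt 0 l) as [|Hl]; [assumption|exfalso].
  destruct (Hf (- l) ltac:(lra)) as [d Hd].
  pose proof (cond_pos d).
  specialize (Hd (d / 2) ltac:(lra)
                ltac:(rewrite Rabs_pos_eq; lra)).
  specialize (Hle (d / 2) ltac:(lra)).
  assert (0 <= (f (t + d / 2) - f t) / (d / 2))
    by (apply Rdiv_le_0_compat; lra).
  apply Rabs_lt_between in Hd; lra.
Qed.

Lemma second_derivative_nonpos_of_midpoint (f f' : R -> R) (t l : R) :
  (forall u, derivable_pt_lim f u (f' u)) -> derivable_pt_lim f' t l ->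
  (forall e, 0 < e -> f (t + e) + f (t - e) <= 2 * f t) -> l <= 0.
Proof.
  intros Hf Hf' Hmid; destruct (Rle_or_lt l 0) as [|Hl]; [assumption|exfalso].
  destruct (Hf' l Hl) as [d Hd].
  pose proof (cond_pos d) as Hd0.
  assert (Hslope : forall h, h <> 0 -> Rabs h < d -> 0 < (f' (t + h) - f' t) / h).
  { intros h Hh Hhd; specialize (Hd h Hh Hhd).
    apply Rabs_lt_between in Hd; lra. }
  destruct (MVT_cor2 f f' t (t + d / 2) ltac:(lra)
              (fun c _ => Hf c)) as (c & Hc & Hct).
  destruct (MVT_cor2 f f' (t - d / 2) t ltac:(lra)
              (fun c _ => Hf c)) as (b & Hb & Hbt).
  assert (Hcs : f' t < f' c).
  { assert (Hs : 0 < (f' (t + (c - t)) - f' t) / (c - t))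
      by (apply Hslope; [lra|apply Rabs_lt_between; lra]).
    replace (t + (c - t)) with c in Hs by ring.
    apply (Rmult_lt_compat_r (c - t)) in Hs; [|lra].
    unfold Rdiv in Hs; rewrite Rmult_assoc, Rinv_l in Hs; lra. }
  assert (Hbs : f' b < f' t).
  { assert (Hs : 0 < (f' (t + (b - t)) - f' t) / (b - t))
      by (apply Hslope; [lra|apply Rabs_lt_between; lra]).
    replace (t + (b - t)) with b in Hs by ring.
    replace ((f' b - f' t) / (b - t)) with ((f' t - f' b) / (t - b)) in Hs
      by (field; lra).
    apply (Rmult_lt_compat_r (t - b)) in Hs; [|lra].
    unfold Rdiv in Hs; rewrite Rmult_assoc, Rinv_l in Hs; lra. }
  specialize (Hmid (d / 2) ltac:(lra)); nra.
Qed.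

(* The partial products without their first factor, which is kept apart
   because it alone makes the final inequalities strict. *)
Definition log_tail (n : nat) (t : R) : R :=
  ln (gauss_prod (nome (exp t)) (S n)) - log_tanh_exp PI t.

Lemma gauss_factor_pos (q : R) (n : nat) :
  0 < q < 1 -> 0 < (1 - q ^ S n) / (1 + q ^ S n).
Proof.
  intros Hq; pose proof (pow_S_lt_1 q n Hq); apply Rdiv_lt_0_compat; lra.
Qed.

Lemma log_gauss_factor (n : nat) (t : R) :
  ln ((1 - nome (exp t) ^ n) / (1 + nome (exp t) ^ n)) =
  log_tanh_exp (INR n * PI) t.
Proof.
  unfold log_tanh_exp, nome; rewrite <- exp_INR_mult.
  replace (INR n * (- PI * exp t)) with (- (INR n * PI * exp t)) by ring.
  reflexivity.
Qed.

Lemma log_tail_0 (t : R) : log_tail 0 t = 0.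
Proof.
  unfold log_tail; cbn [gauss_prod]; rewrite Rmult_1_l, log_gauss_factor.
  simpl INR; rewrite Rmult_1_l; ring.
Qed.

Lemma log_tail_S (n : nat) (t : R) :
  log_tail (S n) t = log_tail n t + log_tanh_exp (INR (S (S n)) * PI) t.
Proof.
  pose proof (nome_bounds (exp t) (exp_pos t)) as Hq.
  rewrite <- log_gauss_factor; unfold log_tail.
  change (gauss_prod (nome (exp t)) (S (S n))) with
    (gauss_prod (nome (exp t)) (S n)
     * ((1 - nome (exp t) ^ S (S n)) / (1 + nome (exp t) ^ S (S n)))).
  rewrite ln_mult; [ring|now apply gauss_prod_pos|now apply gauss_factor_pos].
Qed.

Lemma log_tail_incr (n : nat) (t e : R) :
  0 < e -> log_tail n t <= log_tail n (t + e).
Proof.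
  intros He; induction n as [|n IH]; [rewrite !log_tail_0; lra|].
  rewrite !log_tail_S.
  assert (Ha : 0 < INR (S (S n)) * PI)
    by (apply Rmult_lt_0_compat; [apply lt_0_INR; lia|apply PI_RGT_0]).
  pose proof (log_tanh_exp_incr _ t e Ha He); lra.
Qed.

Lemma log_tail_midpoint (n : nat) (t e : R) :
  0 < e -> log_tail n (t + e) + log_tail n (t - e) <= 2 * log_tail n t.
Proof.
  intros He; induction n as [|n IH]; [rewrite !log_tail_0; lra|].
  rewrite !log_tail_S.
  assert (Ha : 0 < INR (S (S n)) * PI)
    by (apply Rmult_lt_0_compat; [apply lt_0_INR; lia|apply PI_RGT_0]).
  pose proof (log_tanh_exp_midpoint _ t e Ha He); lra.
Qed.

Lemma theta4_pos (s : R) : 0 < s -> 0 < theta4 s.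
Proof.
  intros Hs; rewrite theta4_series by assumption.
  apply theta_series_pos, nome_bounds, Hs.
Qed.

Definition log_tail_limit (t : R) : R :=
  ln (theta4 (exp t)) - log_tanh_exp PI t.

Lemma log_tail_cvg (t : R) :
  is_lim_seq (fun n => log_tail n t) (log_tail_limit t).
Proof.
  pose proof (exp_pos t) as Ht.
  apply is_lim_seq_minus'; [|apply is_lim_seq_const].
  apply (is_lim_seq_continuous ln (fun n => gauss_prod (nome (exp t)) (S n))).
  { apply continuity_pt_filterlim, (ex_derive_continuous ln).
    eexists; apply is_derive_ln, theta4_pos, Ht. }
  apply is_lim_seq_incr_1 with (u := gauss_prod (nome (exp t))).
  rewrite theta4_series by assumption.
  apply gauss_prod_cvg, nome_bounds, Ht.
Qed.

Lemma log_tail_limit_incr (t e : R) :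
  0 < e -> log_tail_limit t <= log_tail_limit (t + e).
Proof.
  intros He.
  exact (is_lim_seq_le _ _ _ _ (fun n => log_tail_incr n t e He)
           (log_tail_cvg t) (log_tail_cvg (t + e))).
Qed.

Lemma log_tail_limit_midpoint (t e : R) :
  0 < e ->
  log_tail_limit (t + e) + log_tail_limit (t - e) <= 2 * log_tail_limit t.
Proof.
  intros He.
  exact (is_lim_seq_le _ _ _ _ (fun n => log_tail_midpoint n t e He)
           (is_lim_seq_plus' _ _ _ _ (log_tail_cvg (t + e)) (log_tail_cvg (t - e)))
           (is_lim_seq_scal_l _ 2 _ (log_tail_cvg t))).
Qed.

Definition log_theta4_exp_d1 (t : R) : R :=
  exp t * theta4_d1 (exp t) / theta4 (exp t).

Definition log_theta4_exp_d2 (s : R) : R :=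
  s * (s * (theta4_d2 s * theta4 s - theta4_d1 s ^ 2) + theta4_d1 s * theta4 s)
  / theta4 s ^ 2.

Lemma log_theta4_exp_derive (t : R) :
  derivable_pt_lim (fun u => ln (theta4 (exp u))) t (log_theta4_exp_d1 t).
Proof.
  pose proof (exp_pos t) as Ht; pose proof (theta4_pos _ Ht).
  apply is_derive_Reals.
  assert (H1 := is_derive_comp theta4 exp t _ _
                  (theta4_derive _ Ht) (is_derive_exp t)).
  assert (H2 := is_derive_comp ln (fun u => theta4 (exp u)) t _ _
                  (is_derive_ln _ (theta4_pos _ Ht)) H1).
  eapply eq_ind; [exact H2|].
  unfold log_theta4_exp_d1, scal; simpl; unfold mult; simpl; field; lra.
Qed.

Lemma log_theta4_exp_derive2 (t : R) :
  derivable_pt_lim log_theta4_exp_d1 t (log_theta4_exp_d2 (exp t)).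
Proof.
  pose proof (exp_pos t) as Ht; pose proof (theta4_pos _ Ht) as Hp.
  apply is_derive_Reals.
  assert (H1 := is_derive_comp theta4 exp t _ _
                  (theta4_derive _ Ht) (is_derive_exp t)).
  assert (H2 := is_derive_comp theta4_d1 exp t _ _
                  (theta4_derive2 _ Ht) (is_derive_exp t)).
  assert (H3 := is_derive_mult exp _ t _ _ (is_derive_exp t) H2 Rmult_comm).
  assert (H4 := is_derive_div _ _ t _ _ H3 H1 ltac:(lra)).
  eapply eq_ind; [exact H4|].
  unfold log_theta4_exp_d2, scal, plus; simpl; unfold mult; simpl; field; lra.
Qed.

Lemma log_theta4_exp_d1_pos (t : R) : 0 < log_theta4_exp_d1 t.
Proof.
  pose proof (log_tanh_exp_d1_pos PI t PI_RGT_0).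
  assert (0 <= log_theta4_exp_d1 t - log_tanh_exp_d1 PI t); [|lra].
  apply (derivative_nonneg_of_le_right log_tail_limit t).
  - apply derivable_pt_lim_minus;
      [apply log_theta4_exp_derive|apply log_tanh_exp_derive, PI_RGT_0].
  - intros e; apply log_tail_limit_incr.
Qed.

Lemma log_theta4_exp_d2_neg (t : R) : log_theta4_exp_d2 (exp t) < 0.
Proof.
  pose proof (log_tanh_exp_d2_neg PI t PI_RGT_0).
  assert (log_theta4_exp_d2 (exp t) - log_tanh_exp_d2 PI t <= 0); [|lra].
  apply (second_derivative_nonpos_of_midpoint log_tail_limit
           (fun u => log_theta4_exp_d1 u - log_tanh_exp_d1 PI u) t).
  - intros u; apply derivable_pt_lim_minus;
      [apply log_theta4_exp_derive|apply log_tanh_exp_derive, PI_RGT_0].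
  - apply derivable_pt_lim_minus;
      [apply log_theta4_exp_derive2|apply log_tanh_exp_derive2, PI_RGT_0].
  - intros e; apply log_tail_limit_midpoint.
Qed.

Theorem theorem4 :
  exists d1 d2 : R -> R,
    (forall s, 0 < s -> derivable_pt_lim theta4 s (d1 s)) /\
    (forall s, 0 < s -> derivable_pt_lim d1 s (d2 s)) /\
    (forall s, 0 < s ->
       d2 s * theta4 s - (d1 s) ^ 2 < - (d1 s * theta4 s) / s /\
       - (d1 s * theta4 s) / s < 0).
Proof.
  exists theta4_d1, theta4_d2.
  split; [|split; [|intros s Hs; split]].
  - intros s Hs; apply is_derive_Reals, theta4_derive, Hs.
  - intros s Hs; apply is_derive_Reals, theta4_derive2, Hs.
  - pose proof (theta4_pos s Hs) as Hp.
    pose proof (log_theta4_exp_d2_neg (ln s)) as Hd.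
    rewrite exp_ln in Hd by assumption; unfold log_theta4_exp_d2 in Hd.
    apply Rlt_div_r; [assumption|].
    apply Rnot_le_lt; intros Hle.
    assert (Hge : 0 <= s * (s * (theta4_d2 s * theta4 s - theta4_d1 s ^ 2)
                        + theta4_d1 s * theta4 s) / theta4 s ^ 2).
    { apply Rdiv_le_0_compat; [|apply pow_lt; assumption].
      apply Rmult_le_pos; lra. }
    lra.
  - pose proof (theta4_pos s Hs) as Hp.
    pose proof (log_theta4_exp_d1_pos (ln s)) as Hd.
    unfold log_theta4_exp_d1 in Hd; rewrite exp_ln in Hd by assumption.
    assert (Hd1 : 0 < theta4_d1 s).
    { apply Rnot_le_lt; intros Hle.
      assert (s * theta4_d1 s / theta4 s <= 0)
        by (apply Rle_div_l; [assumption|nra]).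
      lra. }
    apply Rdiv_neg_pos; nra.
Qed.
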